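(* Let $\Gamma=(G,\sigma)$ be a connected signed graph of order $n>2$ and size $m$, with Laplacian eigenvalues $\mu_1(\Gamma)\ge\mu_2(\Gamma)\ge\cdots\ge\mu_n(\Gamma)$. Let $R=\{u_{1},u_{2},\dots,u_{k}\}$ be a subset of the vertex set of $\Gamma$. If the edge set of the induced signed subgraph $\Gamma[R]$ consists of $r$ pairwise disjoint edges, then $$\sum_{i=1}^{k}\mu_{i}(\Gamma)\ge\sum_{i=1}^{k}d_{\Gamma}(u_{i})+k-r.$$
   Context: A signed graph $\Gamma=(G,\sigma)$ consists of a simple graph $G$ and a map $\sigma:E(G)\to\{+1,-1\}$; it is connected if $G$ is. The Laplacian matrix is $L(\Gamma)=D(\Gamma)-A(\Gamma)$, where $D(\Gamma)$ is the diagonal degree matrix and $A(\Gamma)$ has $(i,j)$-entry $\sigma(v_iv_j)$ if $v_iv_j\in E(G)$ and $0$ otherwise. $d_\Gamma(u)$ is the degree of $u$ in $G$, and $\Gamma[R]$ is the signed subgraph induced by $R$. *)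

(* Defs.v *)
From mathcomp Require Import all_boot all_order all_algebra.

Set Implicit Arguments.
Unset Strict Implicit.
Unset Printing Implicit Defensive.

Import Order.TTheory GRing.Theory Num.Theory.
Local Open Scope ring_scope.

(* Edges are two-element sets of vertices, so the graph is simple.  [sign] is
   total for convenience; only its values on [edges] are constrained or used. *)
Record signed_graph (n : nat) := SignedGraph {
  edges : {set {set 'I_n}};
  sign : {set 'I_n} -> int;
  edges_card2 : forall e, e \in edges -> #|e| = 2;
  sign_pm1 : forall e, e \in edges -> sign e = 1 \/ sign e = -1
}.

Section SignedGraph.
Variables (n : nat) (G : signed_graph n).

(* False when i = j, since [set i; i] has one element. *)
Definition adjacent : rel 'I_n := fun i j => [set i; j] \in edges G.

Definition graph_connected : Prop := forall i j, connect adjacent i j.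

Definition degree (i : 'I_n) : nat := #|[set j | adjacent i j]|.

Definition induced_edges (R : {set 'I_n}) : {set {set 'I_n}} :=
  [set e in edges G | e \subset R].

Variable F : rcfType.

Definition degree_mx : 'M[F]_n := diag_mx (\row_i (degree i)%:R).

Definition adjacency_mx : 'M[F]_n :=
  \matrix_(i, j) (if adjacent i j then (sign G [set i; j])%:~R else 0).

Definition laplacian : 'M[F]_n := degree_mx - adjacency_mx.

End SignedGraph.

(* [mu] lists the eigenvalues of M with multiplicity, in non-increasing order. *)
Definition ordered_eigenvalues (F : rcfType) (n : nat) (M : 'M[F]_n)
    (mu : 'I_n -> F) : Prop :=
  (forall i j : 'I_n, (i <= j)%N -> mu j <= mu i) /\
  char_poly M = \prod_(i < n) ('X - (mu i)%:P).

(* Main.v *)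
Require Import Defs.
From mathcomp Require Import all_boot all_order all_algebra.
From mathcomp Require Import all_fingroup spectral complex ring zify.

Set Implicit Arguments.
Unset Strict Implicit.
Unset Printing Implicit Defensive.

Import Order.TTheory GRing.Theory Num.Theory.
Local Open Scope ring_scope.
Local Open Scope sesquilinear_scope.

(** Write [L = \sum_e b_e b_e^T] over the edges.  Assign to every [u] in [R] a
    nonempty set [S u] of edges at [u], pairwise disjoint, by giving each edge
    inside [R] to only one of its ends; then [\sum_u #|S u| >= \sum_u d(u) - r].
    The vector [y u = (\sum_(e in S u) b_e) / sqrt #|S u|] has squared norm
    [#|S u| + 1], and by Cauchy-Schwarz [\sum_u (y u) (y u)^T <= L] as quadratic
    forms.  Hence in an eigenbasis the weights [w_i = \sum_u |<y u, v_i>|^2 / mu_i]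
    are at most 1 and add up to at most [k], so that [\sum_u |y u|^2], which is
    [\sum_i mu_i w_i], is bounded by the sum of the [k] largest eigenvalues.
    The spectral theorem is applied over [F[i]]. *)

(** * Upper bounds by the sum of the largest eigenvalues *)

(** A fractional knapsack bound. With threshold [c], the value of [mu] at index [k], each term
    [mu i * w i] is at most [mu i + c * (w i - 1)] for [i < k] and at most [c * w i] otherwise. In
    the sum the total correction is [c] times a nonpositive number. If [n <= k] there is no
    threshold, and [w i <= 1] suffices. *)
Lemma sum_weighted_le_top (C : numDomainType) (n k : nat) (mu w : 'I_n -> C) :
    (forall i, 0 <= mu i) ->
    (forall i j : 'I_n, (i <= j)%N -> mu j <= mu i) ->
    (forall i, 0 <= w i <= 1) ->
    \sum_i w i <= k%:R ->
  \sum_i mu i * w i <= \sum_(i < n | (i < k)%N) mu i.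
Proof.
move=> mu_ge0 mu_mono w01 sw.
have [le_nk|lt_kn] := leqP n k.
  rewrite [leRHS]big_mkcond; apply: ler_sum => i _.
  rewrite (leq_trans (ltn_ord i) le_nk) ler_piMr //.
  by case/andP: (w01 i).
pose c := mu (Ordinal lt_kn).
have key : \sum_i mu i * w i <=
    \sum_(i < n | (i < k)%N) mu i + c * (\sum_i w i - k%:R).
  have -> : k%:R = \sum_(i < n | (i < k)%N) (1 : C).
    by rewrite (big_ord_narrow (ltnW lt_kn)) //= sumr_const card_ord.
  rewrite [X in X + _]big_mkcond [X in c * (_ - X)]big_mkcond /=.
  rewrite -sumrB mulr_sumr -big_split; apply: ler_sum => i _ /=.
  have /andP [w0 w1] := w01 i.
  have [lt_ik|le_ki] := ltnP i k.
    have cmu : c <= mu i by apply: mu_mono; rewrite ltnW.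
    rewrite -subr_ge0.
    have -> : mu i + c * (w i - 1) - mu i * w i = (mu i - c) * (1 - w i) by ring.
    by rewrite mulr_ge0 // subr_ge0.
  by rewrite add0r subr0 ler_wpM2r // mu_mono.
apply: (le_trans key); rewrite gerDl.
by apply: mulr_ge0_le0; rewrite ?subr_le0 // mu_ge0.
Qed.

(** The case of a diagonal form. Testing the domination on basis vectors bounds each column weight
    by 1; testing it on dual vectors bounds each row weight by 1, so the weights add up to at most
    [#|R|]. *)
Lemma sum_sqnorm_le_diag (C : numClosedFieldType) (I : finType) (R : {set I})
    (n : nat) (mu : 'I_n -> C) (a : I -> 'I_n -> C) :
    (forall i j : 'I_n, (i <= j)%N -> mu j <= mu i) ->
    (forall c : 'I_n -> C,
      \sum_(u in R) `|\sum_i a u i * c i| ^+ 2 <= \sum_i mu i * `|c i| ^+ 2) ->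
  \sum_(u in R) \sum_i `|a u i| ^+ 2 <= \sum_(i < n | (i < #|R|)%N) mu i.
Proof.
move=> mu_mono dom.
have col_le i : \sum_(u in R) `|a u i| ^+ 2 <= mu i.
  have := dom (fun j => (j == i)%:R).
  rewrite (bigD1 i) //= eqxx normr1 expr1n mulr1 [X in _ + X]big1 ?addr0; last first.
    by move=> j /negPf ->; rewrite normr0 expr0n mulr0.
  congr (_ <= _); apply: eq_bigr => u _; rewrite (bigD1 i) //= eqxx mulr1.
  by rewrite big1 ?addr0 // => j /negPf ->; rewrite mulr0.
have mu_ge0 i : 0 <= mu i.
  by apply: le_trans (col_le i); apply: sumr_ge0 => u _; rewrite exprn_ge0.
have sq_le u i : u \in R -> `|a u i| ^+ 2 <= mu i.
  move=> Ru; apply: le_trans (col_le i); rewrite (bigD1 u) //= lerDl.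
  by apply: sumr_ge0 => v _; rewrite exprn_ge0.
(* Where [mu i = 0] the quotients below are 0 by convention; as [a u i] vanishes there, nothing is
   lost. *)
have a0 u i : u \in R -> mu i = 0 -> a u i = 0.
  move=> Ru mui; apply/eqP; rewrite -normr_eq0 -sqrf_eq0 eq_le exprn_ge0 // andbT.
  by rewrite -mui sq_le.
(* [t u] is the value at [a u] of the form dual to [mu]; testing [dom] on the
   vector realising it gives [t u ^+ 2 <= t u]. *)
pose t u := \sum_i `|a u i| ^+ 2 / mu i.
have t_ge0 u : 0 <= t u by apply: sumr_ge0 => i _; rewrite divr_ge0 ?exprn_ge0.
have t_le1 u : u \in R -> t u <= 1.
  move=> Ru; have := dom (fun i => (a u i)^* / mu i).
  have -> : \sum_i mu i * `|(a u i)^* / mu i| ^+ 2 = t u.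
    apply: eq_bigr => i _; rewrite normrM norm_conjC normfV (ger0_norm (mu_ge0 i)).
    have [mui|mui] := eqVneq (mu i) 0; first by rewrite mui invr0 mul0r mulr0.
    by field.
  rewrite (bigD1 u) //=.
  have -> : \sum_i a u i * ((a u i)^* / mu i) = t u.
    by apply: eq_bigr => i _; rewrite mulrA -normCK.
  rewrite (ger0_norm (t_ge0 u)) => le_t.
  have : t u ^+ 2 <= t u.
    apply: le_trans le_t; rewrite lerDl.
    by apply: sumr_ge0 => v _; rewrite exprn_ge0.
  have [->|tu] := eqVneq (t u) 0; first by rewrite ler01.
  by rewrite expr2 ger_pMr // lt_def tu t_ge0.
pose w i := \sum_(u in R) `|a u i| ^+ 2 / mu i.
have -> : \sum_(u in R) \sum_i `|a u i| ^+ 2 = \sum_i mu i * w i.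
  rewrite exchange_big /=; apply: eq_bigr => i _; rewrite mulr_sumr.
  apply: eq_bigr => u Ru.
  have [mui|mui] := eqVneq (mu i) 0; last by field.
  by rewrite a0 // normr0 expr0n mul0r mulr0.
apply: sum_weighted_le_top => // [i|].
  rewrite sumr_ge0 /=; last by move=> u _; rewrite divr_ge0 ?exprn_ge0.
  rewrite /w -mulr_suml.
  have [->|mui] := eqVneq (mu i) 0; first by rewrite invr0 mulr0 ler01.
  by rewrite ler_pdivrMr ?mul1r // lt_def mui mu_ge0.
rewrite exchange_big -sumr_const; apply: ler_sum => u Ru; exact: t_le1.
Qed.

Lemma char_poly_conj (K : comNzRingType) (n : nat) (P Q A : 'M[K]_n) :
  Q *m P = 1%:M -> char_poly (Q *m A *m P) = char_poly A.
Proof.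
move=> QP; pose f := map_mx (@polyC K) : 'M[K]_n -> 'M[{poly K}]_n.
have fQP : f Q *m f P = 1%:M by rewrite -map_mxM QP map_mx1.
have -> : char_poly (Q *m A *m P) = \det (f Q *m char_poly_mx A *m f P).
  congr (\det _); rewrite /char_poly_mx mulmxBr mulmxBl !map_mxM.
  by rewrite scalar_mxC -[_%:M *m _ *m _]mulmxA fQP mulmx1.
by rewrite !det_mulmx mulrAC -det_mulmx fQP det1 mul1r.
Qed.

Lemma sum_sqnorm_le_top_eigenvalues (C : numClosedFieldType) (I : finType)
    (R : {set I}) (n : nat) (M : 'M[C]_n) (mu : 'I_n -> C) (y : I -> 'rV[C]_n) :
    M \is hermsymmx ->
    (forall i j : 'I_n, (i <= j)%N -> mu j <= mu i) ->
    char_poly M = \prod_(i < n) ('X - (mu i)%:P) ->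
    (forall z : 'rV[C]_n,
      \sum_(u in R) `|(y u *m z^t*) 0 0| ^+ 2 <= (z *m M *m z^t*) 0 0) ->
  \sum_(u in R) \sum_i `|y u 0 i| ^+ 2 <= \sum_(i < n | (i < #|R|)%N) mu i.
Proof.
move=> hM mu_mono cM dom.
have MP := orthomx_spectralP (hermitian_normalmx hM).
have PU := spectral_unitarymx M.
set P := spectralmx M in MP PU; set d := spectral_diag M in MP.
have PtP : P^t* *m P = 1%:M by rewrite -invmx_unitary // mulVmx // unitarymx_unit.
have cd : char_poly M = \prod_(i < n) ('X - (d 0 i)%:P).
  have -> : char_poly M = char_poly (diag_mx d).
    by rewrite MP invmx_unitary // char_poly_conj.
  rewrite char_poly_trig ?diag_mx_is_trig //.
  by apply: eq_bigr => i _; rewrite mxE eqxx mulr1n.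
(* The spectral theorem gives the eigenvalues in no prescribed order; unique factorisation of the
   characteristic polynomial matches them with [mu]. *)
have [s ds] : exists s : 'S_n, forall i, d 0 (s i) = mu i.
  have : perm_eq [tuple mu i | i < n] [tuple d 0 i | i < n].
    apply: prod_XsubC_eq; rewrite !big_tuple.
    under eq_bigr do rewrite tnth_mktuple.
    by under [RHS]eq_bigr do rewrite tnth_mktuple; rewrite -cM -cd.
  case/tuple_permP => s es; exists s => i.
  have /(congr1 (fun x => nth 0 x i)) := es.
  by rewrite -!tnth_nth !tnth_mktuple.
pose a u i := (y u *m P^t*) 0 (s i).
have -> : \sum_(u in R) \sum_i `|y u 0 i| ^+ 2 =
          \sum_(u in R) \sum_i `|a u i| ^+ 2.
  apply: eq_bigr => u _.
  have sq (x : 'rV[C]_n) : \sum_i `|x 0 i| ^+ 2 = (x *m x^t*) 0 0.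
    by rewrite mxE; apply: eq_bigr => i _; rewrite !mxE normCK.
  rewrite -(reindex_inj (h := s) (P := xpredT)
    (F := fun i => `|(y u *m P^t*) 0 i| ^+ 2)) /=; last exact: perm_inj.
  by rewrite !sq trmx_mul map_mxM trmxCK mulmxA -(mulmxA (y u)) PtP mulmx1.
apply: sum_sqnorm_le_diag => // c.
(* The conjugation cancels the one in the sesquilinear pairing, and [s^-1] undoes the reordering. *)
pose x : 'rV[C]_n := \row_i (c (s^-1%g i))^*.
have := dom (x *m P); rewrite trmx_mul map_mxM.
congr (_ <= _).
  apply: eq_bigr => u _; congr (`|_| ^+ 2).
  rewrite mulmxA mxE (reindex_inj (h := s)); last exact: perm_inj.
  by apply: eq_bigr => i _; rewrite /a !mxE permK /= conjCK.
rewrite MP invmx_unitary // !mulmxA !mulmxtVK // mul_mx_diag mxE.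
rewrite (reindex_inj (h := s)); last exact: perm_inj.
apply: eq_bigr => i _; rewrite !mxE permK ds /= conjCK normCK.
by rewrite mulrAC mulrC [_^* * _]mulrC.
Qed.

(** After the triangle inequality, the gap in Cauchy-Schwarz is half of the double sum of
    [(|x i| - |x j|)^2]. *)
Lemma sqnorm_sum_le (C : numClosedFieldType) (I : finType) (S : {set I}) (x : I -> C) :
  `|\sum_(i in S) x i| ^+ 2 <= #|S|%:R * \sum_(i in S) `|x i| ^+ 2.
Proof.
have le_sq : `|\sum_(i in S) x i| ^+ 2 <= (\sum_(i in S) `|x i|) ^+ 2.
  by rewrite lerXn2r ?nnegrE ?sumr_ge0 // ler_norm_sum.
apply: (le_trans le_sq).
have sumS (c : C) : \sum_(j in S) c = #|S|%:R * c by rewrite sumr_const mulr_natl.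
have : 0 <= \sum_(i in S) \sum_(j in S) (`|x i| - `|x j|) ^+ 2.
  apply: sumr_ge0 => i _; apply: sumr_ge0 => j _.
  by apply: real_exprn_even_ge0; rewrite // rpredB ?normr_real.
have -> : \sum_(i in S) \sum_(j in S) (`|x i| - `|x j|) ^+ 2 =
    2 * (#|S|%:R * \sum_(i in S) `|x i| ^+ 2 - (\sum_(i in S) `|x i|) ^+ 2).
  transitivity (\sum_(i in S) (#|S|%:R * `|x i| ^+ 2 +
      \sum_(j in S) `|x j| ^+ 2 - 2 * `|x i| * \sum_(j in S) `|x j|)).
    apply: eq_bigr => i _; rewrite -sumS -big_split mulr_sumr -sumrB /=.
    by apply: eq_bigr => j _; ring.
  rewrite sumrB big_split /= sumS -!mulr_suml -!mulr_sumr; ring.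
by rewrite pmulr_rge0 ?ltr0n // subr_ge0.
Qed.

(** * Star vectors and the quadratic form of the Laplacian *)

Section StarVectors.
Variables (n : nat) (G : signed_graph n).

Lemma adjacentC (i j : 'I_n) : adjacent G i j = adjacent G j i.
Proof. by rewrite /adjacent setUC. Qed.

Lemma adjacent_irr (i : 'I_n) : adjacent G i i = false.
Proof.
apply: contraTF isT => /(edges_card2 (s := G)) /=.
by rewrite setUid cards1.
Qed.

Variable F : rcfType.
Local Notation C := (F[i]%C).
Local Notation L := (map_mx (real_complex F) (laplacian G F)).
Local Notation sg i j := ((sign G [set i; j])%:~R : C).

Lemma laplacian_hermsym : L \is hermsymmx.
Proof.
apply: realsym_hermsym.
  apply/is_hermitianmxP; rewrite expr0 scale1r map_mx_id //.
  apply/matrixP => i j; rewrite !mxE adjacentC setUC eq_sym.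
  by case: eqP => [->|].
apply/mxOverP => i j; rewrite mxE; apply/complex_realP; by eexists.
Qed.

(** The factor 2 appears because the right side meets every edge in both directions. The two shares
    [b i j] and [b j i] add up to the square, since signs square to 1. *)
Lemma laplacian_quadratic (z : 'rV[C]_n) :
  2 * (z *m L *m z^t*) 0 0 =
  \sum_i \sum_(j | adjacent G i j) `|z 0 i - sg i j * z 0 j| ^+ 2.
Proof.
pose b i j := `|z 0 i| ^+ 2 - sg i j * (z 0 i * (z 0 j)^*).
have sgC i j : sg i j = sg j i by rewrite setUC.
have -> : (z *m L *m z^t*) 0 0 = \sum_i \sum_(j | adjacent G i j) b i j.
  transitivity (\sum_i \sum_j z 0 i * L i j * (z 0 j)^*).
    rewrite exchange_big mxE; apply: eq_bigr => j _; rewrite !mxE mulr_suml.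
    by apply: eq_bigr.
  apply: eq_bigr => i _.
  rewrite big_split /= sumr_const.
  transitivity (\sum_j (z 0 i * ((degree G i)%:R *+ (i == j)) * (z 0 j)^* -
     if adjacent G i j then sg i j * (z 0 i * (z 0 j)^*) else 0)).
    apply: eq_bigr => j _; rewrite !mxE rmorphB rmorphMn rmorph_nat.
    rewrite mulrBr mulrBl; congr (_ - _).
    by case: ifP => _; rewrite ?rmorph0 ?mulr0 ?mul0r // rmorph_int; ring.
  rewrite sumrB -big_mkcond sumrN /=; congr (_ - _).
  rewrite (bigD1 i) //= eqxx mulr1n big1 ?addr0; last first.
    by move=> j /negPf; rewrite eq_sym => ->; rewrite mulr0n mulr0 mul0r.
  by rewrite -mulrA mulrCA -normCK mulr_natl /degree cardsE.
rewrite mulr_natl mulr2n.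
rewrite [X in X + _ = _](exchange_big_dep xpredT) //= -big_split /=.
apply: eq_bigr => i _.
rewrite (eq_bigl (adjacent G i)); last by move=> j; rewrite adjacentC.
rewrite -big_split; apply: eq_bigr => j ij /=.
rewrite normCK rmorphB rmorphM rmorph_int /b (sgC j i) !normCK /=.
have sg2 : sg i j ^+ 2 = 1.
  by case: (sign_pm1 ij) => ->; rewrite ?mulrN1z ?sqrrN expr1n.
by move: (sg i j) sg2 => e e2; ring: e2.
Qed.

(** A set of edges at [u] is encoded by their other ends [S u]; [S_asym] says that no edge is chosen
    from both ends. *)
Variables (R : {set 'I_n}) (S : 'I_n -> {set 'I_n}).
Hypothesis S_adj : forall u v, u \in R -> v \in S u -> adjacent G u v.
Hypothesis S_neq0 : forall u, u \in R -> S u != set0.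
Hypothesis S_asym : forall u v, u \in R -> v \in R -> v \in S u -> u \notin S v.

(** This is [y u] of the overview: each [b_e] is scaled to have entry 1 at [u], so these entries add
    up to [#|S u|]. *)
Let star u : 'rV[C]_n := \row_j
  ((if j == u then #|S u|%:R else if j \in S u then - sg u j else 0)
     / sqrtC #|S u|%:R).

Let cardS_gt0 u : u \in R -> 0 < #|S u|%:R :> C.
Proof. by move=> Ru; rewrite ltr0n card_gt0 S_neq0. Qed.

Let sqr_norm_sqrtC u : u \in R -> `|sqrtC #|S u|%:R : C| ^+ 2 = #|S u|%:R.
Proof. by move=> Ru; rewrite -normrX sqrtCK normr_nat. Qed.

(** A general [f] serves both the norm of the star vector and its pairing with [z]. *)
Let sum_star (u : 'I_n) (f : 'I_n -> C -> C) : u \in R -> (forall j, f j 0 = 0) ->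
  \sum_j f j (if j == u then #|S u|%:R else if j \in S u then - sg u j else 0) =
  f u #|S u|%:R + \sum_(j in S u) f j (- sg u j).
Proof.
move=> Ru f0; rewrite (bigD1 u) //= eqxx; congr (_ + _).
rewrite [RHS]big_mkcond [LHS]big_mkcond /=; apply: eq_bigr => j _.
have [->|_] /= := eqVneq j u; last by case: ifP.
by case: ifP => // /(S_adj Ru); rewrite adjacent_irr.
Qed.

(** The centre contributes [#|S u|], and the leaves contribute [1 / #|S u|] each, hence 1 in all. *)
Lemma sqnorm_star u : u \in R -> \sum_i `|star u 0 i| ^+ 2 = #|S u|.+1%:R.
Proof.
move=> Ru; have s0 := cardS_gt0 Ru.
under eq_bigr do rewrite mxE normrM normfV exprMn exprVn sqr_norm_sqrtC //.
rewrite (sum_star (f := fun _ x => `|x| ^+ 2 / #|S u|%:R)) //; last first.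
  by move=> _; rewrite normr0 expr0n mul0r.
rewrite (eq_bigr (fun=> #|S u|%:R^-1)); last first.
  move=> j /(S_adj Ru) uj; rewrite normrN.
  by case: (sign_pm1 uj) => ->; rewrite ?mulrN1z ?normrN normr1 expr1n mul1r.
rewrite sumr_const normr_nat -[_^-1 *+ _]mulr_natl divff ?gt_eqF // expr2 mulfK ?gt_eqF //.
by rewrite natr1.
Qed.

(** Cauchy-Schwarz on each star leaves a sum of edge terms [T u v] in which every edge occurs at
    most once. *)
Lemma star_domination (z : 'rV[C]_n) :
  \sum_(u in R) `|(star u *m z^t*) 0 0| ^+ 2 <= (z *m L *m z^t*) 0 0.
Proof.
pose T i j := `|z 0 i - sg i j * z 0 j| ^+ 2.
have TC i j : adjacent G i j -> T i j = T j i.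
  move=> ij; rewrite /T [[set j; i]]setUC.
  case: (sign_pm1 ij) => ->; rewrite ?mulrN1z ?mul1r ?mulN1r ?opprK.
    by rewrite distrC.
  by rewrite addrC.
have T_ge0 i j : 0 <= T i j by rewrite exprn_ge0.
have star_le u : u \in R -> `|(star u *m z^t*) 0 0| ^+ 2 <= \sum_(v in S u) T u v.
  move=> Ru; have s0 := cardS_gt0 Ru.
  have -> : (star u *m z^t*) 0 0 =
      (\sum_(v in S u) (z 0 u - sg u v * z 0 v)^*) / sqrtC #|S u|%:R.
    rewrite mxE; under eq_bigr do rewrite !mxE mulrAC.
    rewrite -mulr_suml; congr (_ / _).
    rewrite (sum_star (f := fun j x => x * (z 0 j)^*)) //; last first.
      by move=> j; rewrite mul0r.
    rewrite mulr_natl -sumr_const -big_split; apply: eq_bigr => v _ /=.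
    by rewrite rmorphB rmorphM rmorph_int mulNr.
  rewrite normrM normfV exprMn exprVn sqr_norm_sqrtC // ler_pdivrMr // mulrC.
  apply: le_trans (sqnorm_sum_le _ _) _; rewrite ler_pM2l //.
  by apply: ler_sum => v _; rewrite norm_conjC.
rewrite -(ler_pM2l (x := 2)) ?ltr0n // laplacian_quadratic.
apply: (@le_trans _ _ (2 * \sum_(u in R) \sum_(v in S u) T u v)).
  by rewrite ler_pM2l ?ltr0n //; apply: ler_sum.
pose chi i j : bool := (i \in R) && (j \in S i).
have sum_chi : \sum_(u in R) \sum_(v in S u) T u v = \sum_i \sum_j T i j *+ chi i j.
  rewrite big_mkcond; apply: eq_bigr => i _; rewrite /chi.
  case: ifP => Ri /=; last by rewrite big1.
  by rewrite big_mkcond; apply: eq_bigr => j _; case: ifP.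
(* Doubling is spent on adding the transposed sum, so that the comparison holds for each ordered
   pair: at most one of [chi i j] and [chi j i] is true. *)
rewrite mulr_natl mulr2n sum_chi [X in X + _]exchange_big /= -big_split /=.
apply: ler_sum => i _; rewrite [leRHS]big_mkcond -big_split /=.
apply: ler_sum => j _; rewrite -/(T i j).
have chi_adj a b : chi a b -> adjacent G a b by case/andP => Ra; apply: S_adj.
case cij: (chi i j); case cji: (chi j i); rewrite ?addr0 ?add0r ?mulr1n ?mulr0n ?addr0.
- case/andP: cij cji => Ri Sij /andP [Rj]; by rewrite (negPf (S_asym Ri Rj Sij)).
- by rewrite chi_adj.
- by rewrite (adjacentC i) chi_adj // TC // chi_adj.
- by case: ifP.
Qed.

Lemma sum_star_le_eigenvalues (mu : 'I_n -> F) :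
  ordered_eigenvalues (laplacian G F) mu ->
  \sum_(u in R) #|S u|.+1%:R <= \sum_(i < n | (i < #|R|)%N) mu i.
Proof.
case=> mu_mono cp; rewrite -lecR !rmorph_sum /=.
have -> : \sum_(u in R) real_complex F #|S u|.+1%:R =
    \sum_(u in R) \sum_i `|star u 0 i| ^+ 2.
  by apply: eq_bigr => u Ru; rewrite sqnorm_star // rmorph_nat.
apply: (sum_sqnorm_le_top_eigenvalues laplacian_hermsym) => //.
- by move=> i j ij; rewrite lecR mu_mono.
- rewrite -map_char_poly cp rmorph_prod; apply: eq_bigr => i _.
  by rewrite rmorphB /= map_polyX map_polyC.
- exact: star_domination.
Qed.

End StarVectors.

(** * Assigning each edge inside [R] to one of its ends *)

Section Orientation.
Variables (n : nat) (G : signed_graph n).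
Hypotheses (n_gt2 : (2 < n)%N) (G_conn : graph_connected G).

(** Otherwise [A] would be closed under adjacency and, by connectedness, contain every vertex. *)
Lemma exists_adjacent_out (A : {set 'I_n}) (u : 'I_n) :
  u \in A -> (#|A| < n)%N -> exists v w, [/\ v \in A, w \notin A & adjacent G v w].
Proof.
move=> Au cA.
have /existsP [x xA] : [exists x, x \notin A].
  rewrite -negb_forall; apply: contraL cA => /forallP allA.
  by rewrite -leqNgt -[X in (X <= _)%N]card_ord subset_leq_card //; apply/subsetP.
have [/existsP [v /existsP [w /and3P[]]]|] :=
    boolP [exists v, exists w, [&& v \in A, w \notin A & adjacent G v w]].
  by exists v, w.
move/existsPn => noA.
have clA : closed (adjacent G) A.
  apply: intro_closed; first by apply: sym_connect_sym => ? ?; rewrite adjacentC.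
  move=> v w vw Av; have /existsPn/(_ w) := noA v.
  by rewrite Av vw andbT negbK.
by rewrite -(closed_connect clA (G_conn u x)) Au in xA.
Qed.

Variable R : {set 'I_n}.
Hypothesis R_disj : trivIset (induced_edges G R).

Lemma induced_neighbour_uniq u v w : u \in R -> v \in R -> w \in R ->
  adjacent G u v -> adjacent G u w -> v = w.
Proof.
move=> Ru Rv Rw uv uw.
have mem_ind x : x \in R -> adjacent G u x -> [set u; x] \in induced_edges G R.
  by move=> Rx ux; rewrite inE [_ \in _]ux; apply/subsetP => y /set2P [] ->.
have [e|ne] := eqVneq [set u; v] [set u; w].
  have : v \in [set u; w] by rewrite -e set22.
  case/set2P => // vu; by rewrite vu adjacent_irr in uv.
have := trivIsetP R_disj _ _ (mem_ind v Rv uv) (mem_ind w Rw uw) ne.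
by move/disjointFr => /(_ u (set21 _ _)); rewrite set21.
Qed.

(* An edge inside [R] is taken away from its end of larger degree, which by
   connectedness keeps at least one other edge. *)
Definition loses (u v : 'I_n) : bool :=
  [&& u \in R, v \in R, adjacent G u v &
    (degree G v < degree G u)%N || (degree G v == degree G u) && (v < u)%N].

Definition kept (u : 'I_n) : {set 'I_n} :=
  [set v | adjacent G u v && ~~ loses u v].

Lemma loses_asym u v : loses u v -> ~~ loses v u.
Proof. by case/and4P => _ _ _ h; apply/negP => /and4P [_ _ _]; lia. Qed.

Lemma kept_adj u v : v \in kept u -> adjacent G u v.
Proof. by rewrite inE => /andP []. Qed.

Lemma kept_asym u v : u \in R -> v \in R -> v \in kept u -> u \notin kept v.
Proof.
move=> Ru Rv; rewrite !inE (adjacentC _ v) => /andP [uv]; rewrite uv /=.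
rewrite /loses Ru Rv uv (adjacentC _ v) uv /= => h.
(* For distinct ends the comparison by degree, then by index, is total, so one of them loses the
   edge. *)
have : u != v by apply: contraTneq uv => ->; rewrite adjacent_irr.
by rewrite -val_eqE /=; move: h; lia.
Qed.

Lemma kept_neq0 u : kept u != set0.
Proof.
have [v uv] : exists v, adjacent G u v.
  have [//|x [v [/set1P-> _ uv]]] := @exists_adjacent_out [set u] u (set11 _).
    by rewrite cards1; lia.
  by exists v.
apply/set0Pn.
have [luv|nl] := boolP (loses u v); last by exists v; rewrite inE uv.
have /and4P [Ru Rv _ le_deg] := luv.
(* The lost edge is the only edge at [u] inside [R], so any other edge at [u] is kept. *)
suff [w uw wv] : exists2 w, adjacent G u w & w != v.
  exists w; rewrite inE uw; apply: contra wv => /and4P [_ Rw _ _].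
  by apply/eqP/(@induced_neighbour_uniq u).
(* As [n > 2], some edge leaves the pair [u], [v]. If it starts at [u] it is the one sought; if at
   [v], then [v] has degree at least 2, and so has [u], whose degree is no smaller. *)
have [|x [w [/set2P [] -> nw xw]]] := @exists_adjacent_out [set u; v] u (set21 _ _).
- by rewrite cards2; lia.
- by exists w => //; apply: contraNneq nw => ->; rewrite set22.
have deg2 : (1 < degree G v)%N.
  rewrite /degree (cardsD1 u) (cardsD1 w) !inE adjacentC uv xw.
  by case: eqP nw => // ->; rewrite set21.
have : (1 < degree G u)%N by lia.
rewrite /degree (cardsD1 v) inE uv ltnS card_gt0 => /set0Pn [y].
by rewrite !inE => /andP [yv uy]; exists y.
Qed.

(** The pairs [(u, v)] for which [u] loses [v] inject into the edges inside [R], since an edge is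
    never lost by both ends. *)
Lemma card_kept : (\sum_(u in R) degree G u <=
  \sum_(u in R) #|kept u| + #|induced_edges G R|)%N.
Proof.
pose Lo := [set p : 'I_n * 'I_n | loses p.1 p.2].
have -> : (\sum_(u in R) degree G u =
    \sum_(u in R) #|kept u| + \sum_(u in R) #|[set v | loses u v]|)%N.
  rewrite -big_split; apply: eq_bigr => u _ /=.
  rewrite /degree -(cardsID [set v | loses u v]) addnC; congr (_ + _)%N.
    by apply: eq_card => v; rewrite !inE andbC.
  by apply: eq_card => v; rewrite !inE andb_idl // => /and4P [].
rewrite leq_add2l.
have -> : (\sum_(u in R) #|[set v | loses u v]| = #|Lo|)%N.
  under eq_bigr do rewrite -sum1dep_card.
  rewrite pair_big_dep -sum1dep_card /=; apply: eq_bigl => p.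
  by rewrite andb_idl // => /and4P [].
rewrite -(card_in_imset (f := fun p => [set p.1; p.2])).
  apply: subset_leq_card; apply/subsetP => e /imsetP [[u v]].
  rewrite inE /= => /and4P [Ru Rv uv _] ->; rewrite inE [_ \in _]uv.
  by apply/subsetP => x /set2P [] ->.
move=> [u v] [x y]; rewrite !inE /= => luv lxy e.
have : u \in [set x; y] by rewrite -e set21.
have : v \in [set x; y] by rewrite -e set22.
have irr a : ~~ loses a a by rewrite /loses adjacent_irr !andbF.
case/set2P => ev /set2P [] eu; subst => //.
- by rewrite (negPf (irr _)) in luv.
- by rewrite (negPf (loses_asym lxy)) in luv.
- by rewrite (negPf (irr _)) in luv.
Qed.

End Orientation.

Theorem theorem1p4 (F : rcfType) (n m : nat) (G : signed_graph n)
  (hn : (2 < n)%N) (hm : #|edges G| = m) (hconn : graph_connected G)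
  (mu : 'I_n -> F) (hmu : ordered_eigenvalues (laplacian G F) mu)
  (R : {set 'I_n}) (k r : nat) (hk : #|R| = k)
  (hdisj : trivIset (induced_edges G R)) (hr : #|induced_edges G R| = r) :
  \sum_(i < n | (i < k)%N) mu i >=
    \sum_(u in R) (degree G u)%:R + k%:R - r%:R.
Proof.
have le_mu : \sum_(u in R) #|kept G R u|.+1%:R <= \sum_(i < n | (i < k)%N) mu i.
  rewrite -hk; apply: sum_star_le_eigenvalues hmu => [u v _|u _|].
  - exact: kept_adj.
  - exact: kept_neq0.
  - exact: kept_asym.
(* The [+1] in each squared norm adds up to [k], and the lost edges account for [r]. *)
apply: le_trans le_mu; rewrite -hk -hr lerBlDr -!natr_sum -!natrD ler_nat.
under [X in (_ <= X + _)%N]eq_bigr do rewrite -addn1.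
by rewrite big_split /= sum1_card addnAC leq_add2r card_kept.
Qed.
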